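(* Let $F$ be the free Lie superalgebra over $\mathbb{K}$ on a $\mathbb{Z}_2$-graded set $X$. Then the homomorphism $F\wedge F\to F$, $x\wedge y\mapsto[x,y]$, from the non-abelian exterior product of $F$ with itself is injective.
   Context: $\mathbb{K}$ is a unital commutative ring. A supermodule is a $\mathbb{K}$-module $M=M_{\bar0}\oplus M_{\bar1}$ graded by $\mathbb{Z}_2$; $|m|$ is the degree of a homogeneous element, and elements occurring in formulas with degrees are homogeneous. A Lie superalgebra is a supermodule $M$ with a bilinear bracket, $[M_{\alpha},M_{\beta}]\subseteq M_{\alpha+\beta}$, such that $[x,y]=-(-1)^{|x||y|}[y,x]$ and $[x,[y,z]]=[[x,y],z]+(-1)^{|x||y|}[y,[x,z]]$ for homogeneous $x,y,z$, and $[x,x]=0$ for $x\in M_{\bar0}$. Homomorphisms are degree-preserving linear maps preserving brackets. The free Lie superalgebra on a $\mathbb{Z}_2$-graded set $X=X_{\bar0}\cup X_{\bar1}$ is a Lie superalgebra $F$ with a degree-preserving map $i\colon X\to F$ such that for every degree-preserving map $j\colon X\to M$ to a Lie superalgebra there is a unique Lie superalgebra homomorphism $h\colon F\to M$ with $j=h\circ i$. For a Lie superalgebra $M$, the non-abelian tensor product $M\otimes M$ (with $M$ acting on itself by ${}^mm'=[m,m']$) is the Lie superalgebra generated by symbols $m\otimes n$ ($m,n$ homogeneous in $M$), of degree $|m|+|n|$, subject to: (i) $\lambda(m\otimes n)=\lambda m\otimes n=m\otimes\lambda n$ for $\lambda\in\mathbb{K}$; (ii) additivity in each variable among elements of equal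 degree; (iii) $[m,m']\otimes n=m\otimes[m',n]-(-1)^{|m||m'|}(m'\otimes[m,n])$ and $m\otimes[n,n']=(-1)^{|n'|(|m|+|n|)}([n',m]\otimes n)-(-1)^{|m||n|}([n,m]\otimes n')$; (iv) $[m\otimes n,m'\otimes n']=-(-1)^{|m||n|}([n,m]\otimes[m',n'])$. The non-abelian exterior product $M\wedge M$ is the quotient of $M\otimes M$ by the graded submodule (which is a central graded ideal) generated by $m\otimes m'+(-1)^{|m||m'|}m'\otimes m$ for homogeneous $m,m'\in M$ and by $m_{\bar0}\otimes m_{\bar0}$ for $m_{\bar0}\in M_{\bar0}$; $m\wedge n$ is the class of $m\otimes n$. *)

(* Defs.v *)
From HB Require Import structures.
From mathcomp Require Import all_boot ssralg boolp.

Set Implicit Arguments.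
Unset Strict Implicit.
Unset Printing Implicit Defensive.

Import GRing.Theory.

Local Open Scope ring_scope.
Local Open Scope quotient_scope.

(* Degrees in Z_2 are booleans, [a (+) b] being their sum.  [sgn a b] is the  *)
(* Koszul sign (-1)^{a b}.                                                    *)
Definition sgn {K : comPzRingType} (a b : bool) : K := (-1) ^+ (a && b).

(* [homog a x] means that x lies in the summand of degree a; thus 0 is        *)
(* homogeneous of both degrees.                                               *)
HB.mixin Record Lmodule_isSupermodule (K : comPzRingType) (M : Type)
    of GRing.Lmodule K M := {
  homog : bool -> M -> Prop;
  homog0 : forall a, homog a 0;
  homogD : forall a x y, homog a x -> homog a y -> homog a (x + y);
  homogZ : forall a (k : K) x, homog a x -> homog a (k *: x);
  homog_sum : forall x, exists x0 x1,
    [/\ homog false x0, homog true x1 & x = x0 + x1];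
  homog_direct : forall x, homog false x -> homog true x -> x = 0
}.

#[short(type="supermodType")]
HB.structure Definition Supermodule (K : comPzRingType) :=
  {M of Lmodule_isSupermodule K M & GRing.Lmodule K M}.

HB.mixin Record Supermodule_isLieSuperalgebra (K : comPzRingType) (M : Type)
    of Supermodule K M := {
  br : M -> M -> M;
  brDl : forall x y z, br (x + y) z = br x z + br y z;
  brDr : forall x y z, br x (y + z) = br x y + br x z;
  brZl : forall (k : K) x y, br (k *: x) y = k *: br x y;
  brZr : forall (k : K) x y, br x (k *: y) = k *: br x y;
  homog_br : forall a b x y,
    homog a x -> homog b y -> homog (a (+) b) (br x y);
  br_anti : forall a b x y, homog a x -> homog b y ->
    br x y = - (sgn a b *: br y x);
  br_jacobi : forall a b c x y z, homog a x -> homog b y -> homog c z ->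
    br x (br y z) = br (br x y) z + sgn a b *: br y (br x z);
  br_even : forall x, homog false x -> br x x = 0
}.

#[short(type="lieSuperalgType")]
HB.structure Definition LieSuperalgebra (K : comPzRingType) :=
  {M of Supermodule_isLieSuperalgebra K M & Supermodule K M}.

Arguments homogD {K s} [a x y] : rename.
Arguments homogZ {K s} [a] k [x] : rename.
Arguments homog_direct {K s} [x] : rename.
Arguments homog_br {K s} [a b x y] : rename.
Arguments br_anti {K s} [a b x y] : rename.
Arguments br_jacobi {K s} [a b c x y z] : rename.
Arguments br_even {K s} [x] : rename.

HB.mixin Record isLieSuperHom (K : comPzRingType) (M N : lieSuperalgType K)
    (f : M -> N) := {
  lie_homog : forall a x, homog a x -> homog a (f x);
  lie_br : forall x y, f (br x y) = br (f x) (f y)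
}.

#[short(type="lieSuperHom")]
HB.structure Definition LieSuperHom (K : comPzRingType)
    (M N : lieSuperalgType K) :=
  {f of isLieSuperHom K M N f & @GRing.Linear K M N *:%R f}.

Definition is_free_lie_superalgebra (K : comPzRingType) (X : Type)
    (deg : X -> bool) (F : lieSuperalgType K) (i : X -> F) : Prop :=
  (forall x, homog (deg x) (i x)) /\
  forall (M : lieSuperalgType K) (j : X -> M),
    (forall x, homog (deg x) (j x)) ->
    exists h : lieSuperHom F M,
      (forall x, h (i x) = j x) /\
      forall h' : lieSuperHom F M, (forall x, h' (i x) = j x) -> h' =1 h.

Section SuperTheory.
Variables (K : comPzRingType) (M : supermodType K).

Lemma homogN a (x : M) : homog a x -> homog a (- x).
Proof. by rewrite -scaleN1r; apply: homogZ. Qed.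

Lemma homog_split a (x y : M) :
  homog a x -> homog (~~ a) y -> x + y = 0 -> x = 0 /\ y = 0.
Proof.
move=> hx hy exy; have ex : x = - y by apply/eqP; rewrite -addr_eq0 exy.
have hx' : homog (~~ a) x by rewrite ex; apply: homogN.
have x0 : x = 0 by case: a hx hy hx' => ? ? ?; apply: homog_direct.
by split=> //; rewrite -exy x0 add0r.
Qed.

End SuperTheory.

Section LieTheory.
Variables (K : comPzRingType) (M : lieSuperalgType K).
Implicit Types x y z : M.

Lemma br0l x : br 0 x = 0.
Proof. by rewrite -[X in br X _](scale0r (0 : M)) brZl scale0r. Qed.

Lemma br0r x : br x 0 = 0.
Proof. by rewrite -[X in br _ X](scale0r (0 : M)) brZr scale0r. Qed.

Lemma brNl x y : br (- x) y = - br x y.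
Proof. by rewrite -scaleN1r brZl scaleN1r. Qed.

Lemma brNr x y : br x (- y) = - br x y.
Proof. by rewrite -scaleN1r brZr scaleN1r. Qed.

(* The components of an element killed by ad z, z homogeneous, are killed.    *)
Lemma br_split c z x0 x1 : homog c z -> homog false x0 -> homog true x1 ->
  br z (x0 + x1) = 0 -> br z x0 = 0 /\ br z x1 = 0.
Proof.
move=> hz h0 h1; rewrite brDr; apply: (homog_split (a := c)).
  by rewrite -[c]addbF; apply: homog_br.
by rewrite -addbT; apply: homog_br.
Qed.

Lemma br_killed c z x y : homog c z -> br z x = 0 -> br z y = 0 ->
  br z (br x y) = 0.
Proof.
move=> hz; have [x0 [x1 [hx0 hx1 ->]]] := homog_sum x.
have [y0 [y1 [hy0 hy1 ->]]] := homog_sum y.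
move=> /(br_split hz hx0 hx1)[zx0 zx1] /(br_split hz hy0 hy1)[zy0 zy1].
rewrite !(brDl, brDr) (br_jacobi hz hx0 hy0) (br_jacobi hz hx0 hy1).
rewrite (br_jacobi hz hx1 hy0) (br_jacobi hz hx1 hy1).
by rewrite zx0 zx1 zy0 zy1 !(br0l, br0r) !scaler0 !addr0.
Qed.

Lemma br_killedC c z : homog c z -> (forall x, br z x = 0) ->
  forall x, br x z = 0.
Proof.
move=> hz zx x; have [x0 [x1 [h0 h1 ->]]] := homog_sum x.
by rewrite brDl (br_anti h0 hz) (br_anti h1 hz) !zx !scaler0 !oppr0 addr0.
Qed.

End LieTheory.

Record hpart (K : comPzRingType) (M : supermodType K) (a : bool) :=
  HPart { hval : M; hvalP : homog a hval }.

Section HomogeneousOperations.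
Variables (K : comPzRingType) (M : lieSuperalgType K).

Definition hadd a (m n : hpart M a) : hpart M a :=
  HPart (homogD (hvalP m) (hvalP n)).
Definition hscale a (k : K) (m : hpart M a) : hpart M a :=
  HPart (homogZ k (hvalP m)).
Definition hbr a b (m : hpart M a) (n : hpart M b) : hpart M (a (+) b) :=
  HPart (homog_br (hvalP m) (hvalP n)).

End HomogeneousOperations.

(* Quotient of raw operations by a congruence satisfying, up to equivalence,  *)
(* the axioms of a K-module with a bilinear product.                          *)
Record preAlg (K : comPzRingType) := PreAlg {
  pcar :> choiceType;
  peqv : pcar -> pcar -> Prop;
  pzero : pcar;
  padd : pcar -> pcar -> pcar;
  popp : pcar -> pcar;
  pscale : K -> pcar -> pcar;
  pbr : pcar -> pcar -> pcar;
  peqv_refl : forall x, peqv x x;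
  peqv_sym : forall x y, peqv x y -> peqv y x;
  peqv_trans : forall x y z, peqv x y -> peqv y z -> peqv x z;
  padd_eqv : forall x x' y y',
    peqv x x' -> peqv y y' -> peqv (padd x y) (padd x' y');
  popp_eqv : forall x x', peqv x x' -> peqv (popp x) (popp x');
  pscale_eqv : forall k x x', peqv x x' -> peqv (pscale k x) (pscale k x');
  pbr_eqv : forall x x' y y',
    peqv x x' -> peqv y y' -> peqv (pbr x y) (pbr x' y');
  paddA : forall x y z, peqv (padd x (padd y z)) (padd (padd x y) z);
  paddC : forall x y, peqv (padd x y) (padd y x);
  padd0 : forall x, peqv (padd pzero x) x;
  paddN : forall x, peqv (padd (popp x) x) pzero;
  pscaleA : forall k l x, peqv (pscale k (pscale l x)) (pscale (k * l) x);
  pscale1 : forall x, peqv (pscale 1 x) x;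
  pscaleDr : forall k x y,
    peqv (pscale k (padd x y)) (padd (pscale k x) (pscale k y));
  pscaleDl : forall k l x,
    peqv (pscale (k + l) x) (padd (pscale k x) (pscale l x));
  pbrDl : forall x y z, peqv (pbr (padd x y) z) (padd (pbr x z) (pbr y z));
  pbrDr : forall x y z, peqv (pbr x (padd y z)) (padd (pbr x y) (pbr x z));
  pbrZl : forall k x y, peqv (pbr (pscale k x) y) (pscale k (pbr x y));
  pbrZr : forall k x y, peqv (pbr x (pscale k y)) (pscale k (pbr x y))
}.

Section PreAlgQuotient.
Variables (K : comPzRingType) (P : preAlg K).

Definition peqvb : rel P := fun x y => `[< peqv x y >].

Lemma peqvb_refl : reflexive peqvb.
Proof. by move=> x; apply/asboolP/peqv_refl. Qed.

Lemma peqvb_sym : symmetric peqvb.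
Proof.
by move=> x y; apply/idP/idP => /asboolP h; apply/asboolP/peqv_sym.
Qed.

Lemma peqvb_trans : transitive peqvb.
Proof.
by move=> y x z /asboolP h1 /asboolP h2; apply/asboolP/(peqv_trans h1 h2).
Qed.

Canonical peqvb_equiv := EquivRel peqvb peqvb_refl peqvb_sym peqvb_trans.

Definition pquot : Type := {eq_quot peqvb}.
HB.instance Definition _ := Choice.on pquot.

Definition pcls (x : P) : pquot := \pi_({eq_quot peqvb}) x.

Lemma pcls_eq x y : pcls x = pcls y <-> peqv x y.
Proof.
split; first by move/eqmodP/asboolP.
by move=> h; apply/eqmodP/asboolP.
Qed.

Definition prep (q : pquot) : P := repr (q : {eq_quot peqvb}).

Lemma prepK q : pcls (prep q) = q.
Proof. exact: (@reprK _ {eq_quot peqvb}). Qed.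

Lemma pclsP q : exists x, q = pcls x.
Proof. by exists (prep q); rewrite prepK. Qed.

Lemma prep_cls x : peqv (prep (pcls x)) x.
Proof. by apply/pcls_eq; rewrite prepK. Qed.

Definition qzero := pcls (pzero P).
Definition qadd q r := pcls (padd (prep q) (prep r)).
Definition qopp q := pcls (popp (prep q)).
Definition qscale k q := pcls (pscale k (prep q)).
Definition qbr q r := pcls (pbr (prep q) (prep r)).

Lemma qaddE x y : qadd (pcls x) (pcls y) = pcls (padd x y).
Proof. by apply/pcls_eq/padd_eqv; apply: prep_cls. Qed.
Lemma qoppE x : qopp (pcls x) = pcls (popp x).
Proof. by apply/pcls_eq/popp_eqv; apply: prep_cls. Qed.
Lemma qscaleE k x : qscale k (pcls x) = pcls (pscale k x).
Proof. by apply/pcls_eq/pscale_eqv; apply: prep_cls. Qed.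
Lemma qbrE x y : qbr (pcls x) (pcls y) = pcls (pbr x y).
Proof. by apply/pcls_eq/pbr_eqv; apply: prep_cls. Qed.

Lemma qaddA : associative qadd.
Proof.
move=> q r s; have [x ->] := pclsP q; have [y ->] := pclsP r.
by have [z ->] := pclsP s; rewrite !qaddE; apply/pcls_eq/paddA.
Qed.

Lemma qaddC : commutative qadd.
Proof.
move=> q r; have [x ->] := pclsP q; have [y ->] := pclsP r.
by rewrite !qaddE; apply/pcls_eq/paddC.
Qed.

Lemma qadd0 : left_id qzero qadd.
Proof.
by move=> q; have [x ->] := pclsP q; rewrite qaddE; apply/pcls_eq/padd0.
Qed.

Lemma qaddN : left_inverse qzero qopp qadd.
Proof.
by move=> q; have [x ->] := pclsP q; rewrite qoppE qaddE; apply/pcls_eq/paddN.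
Qed.

HB.instance Definition _ := GRing.isZmodule.Build pquot qaddA qaddC qadd0 qaddN.

Lemma qscaleA k l q : qscale k (qscale l q) = qscale (k * l) q.
Proof. by have [x ->] := pclsP q; rewrite !qscaleE; apply/pcls_eq/pscaleA. Qed.

Lemma qscale1 : left_id 1 qscale.
Proof.
by move=> q; have [x ->] := pclsP q; rewrite qscaleE; apply/pcls_eq/pscale1.
Qed.

Lemma qscaleDr : right_distributive qscale +%R.
Proof.
move=> k q r; have [x ->] := pclsP q; have [y ->] := pclsP r.
by rewrite [_ + _]qaddE !qscaleE [RHS]qaddE; apply/pcls_eq/pscaleDr.
Qed.

Lemma qscaleDl q : {morph qscale^~ q : k l / k + l}.
Proof.
move=> k l; have [x ->] := pclsP q.
by rewrite /= !qscaleE [RHS]qaddE; apply/pcls_eq/pscaleDl.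
Qed.

HB.instance Definition _ := GRing.Zmodule_isLmodule.Build K pquot
  qscaleA qscale1 qscaleDr qscaleDl.

Lemma pcls0 : pcls (pzero P) = 0. Proof. by []. Qed.
Lemma pclsD x y : pcls (padd x y) = pcls x + pcls y.
Proof. by rewrite -qaddE. Qed.
Lemma pclsN x : pcls (popp x) = - pcls x.
Proof. by rewrite -qoppE. Qed.
Lemma pclsZ k x : pcls (pscale k x) = k *: pcls x.
Proof. by rewrite -qscaleE. Qed.

Lemma qbrDl q r s : qbr (q + r) s = qbr q s + qbr r s.
Proof.
have [x ->] := pclsP q; have [y ->] := pclsP r; have [z ->] := pclsP s.
by rewrite -pclsD !qbrE -pclsD; apply/pcls_eq/pbrDl.
Qed.

Lemma qbrDr q r s : qbr q (r + s) = qbr q r + qbr q s.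
Proof.
have [x ->] := pclsP q; have [y ->] := pclsP r; have [z ->] := pclsP s.
by rewrite -pclsD !qbrE -pclsD; apply/pcls_eq/pbrDr.
Qed.

Lemma qbrZl k q r : qbr (k *: q) r = k *: qbr q r.
Proof.
have [x ->] := pclsP q; have [y ->] := pclsP r.
by rewrite -pclsZ !qbrE -pclsZ; apply/pcls_eq/pbrZl.
Qed.

Lemma qbrZr k q r : qbr q (k *: r) = k *: qbr q r.
Proof.
have [x ->] := pclsP q; have [y ->] := pclsP r.
by rewrite -pclsZ !qbrE -pclsZ; apply/pcls_eq/pbrZr.
Qed.

Lemma qbr0l q : qbr 0 q = 0.
Proof. by rewrite -[X in qbr X _](scale0r (0 : pquot)) qbrZl scale0r. Qed.

Lemma qbr0r q : qbr q 0 = 0.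
Proof. by rewrite -[X in qbr _ X](scale0r (0 : pquot)) qbrZr scale0r. Qed.

Lemma qbrNl q r : qbr (- q) r = - qbr q r.
Proof. by rewrite -scaleN1r qbrZl scaleN1r. Qed.

Lemma qbrNr q r : qbr q (- r) = - qbr q r.
Proof. by rewrite -scaleN1r qbrZr scaleN1r. Qed.

End PreAlgQuotient.

(* The non-abelian tensor product is presented as formal Lie superalgebra     *)
(* expressions in the symbols m (x) n, modulo the least congruence that       *)
(* contains the Lie superalgebra axioms and the defining relations.  Symbols  *)
(* are indexed by degrees; the copies of 0 (x) n in the two degrees of 0 are  *)
(* both identified with 0 by scaling.                                         *)
Inductive tterm (K : comPzRingType) (M : supermodType K) : Type :=
| TSym a b of hpart M a & hpart M b
| TZero
| TAdd of tterm M & tterm M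
| TOpp of tterm M
| TScale of K & tterm M
| TBr of tterm M & tterm M.

Arguments TSym {K M a b}.
Arguments TZero {K M}.

HB.instance Definition _ (K : comPzRingType) (M : supermodType K) :=
  gen_eqMixin (tterm M).
HB.instance Definition _ (K : comPzRingType) (M : supermodType K) :=
  gen_choiceMixin (tterm M).

Section TensorProduct.
Variables (K : comPzRingType) (M : lieSuperalgType K).
Local Notation term := (tterm M).

Inductive thomog : bool -> term -> Prop :=
| thomog_sym a b (m : hpart M a) (n : hpart M b) : thomog (a (+) b) (TSym m n)
| thomog_zero a : thomog a TZero
| thomog_add a s t : thomog a s -> thomog a t -> thomog a (TAdd s t)
| thomog_opp a s : thomog a s -> thomog a (TOpp s)
| thomog_scale a k s : thomog a s -> thomog a (TScale k s)
| thomog_br a b s t : thomog a s -> thomog b t -> thomog (a (+) b) (TBr s t).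

Inductive teqv : term -> term -> Prop :=
| te_refl s : teqv s s
| te_sym s t : teqv s t -> teqv t s
| te_trans s t u : teqv s t -> teqv t u -> teqv s u
| te_add s s' t t' : teqv s s' -> teqv t t' -> teqv (TAdd s t) (TAdd s' t')
| te_opp s s' : teqv s s' -> teqv (TOpp s) (TOpp s')
| te_scale k s s' : teqv s s' -> teqv (TScale k s) (TScale k s')
| te_br s s' t t' : teqv s s' -> teqv t t' -> teqv (TBr s t) (TBr s' t')
| te_addA s t u : teqv (TAdd s (TAdd t u)) (TAdd (TAdd s t) u)
| te_addC s t : teqv (TAdd s t) (TAdd t s)
| te_add0 s : teqv (TAdd TZero s) s
| te_addN s : teqv (TAdd (TOpp s) s) TZero
| te_scaleA k l s : teqv (TScale k (TScale l s)) (TScale (k * l) s)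
| te_scale1 s : teqv (TScale 1 s) s
| te_scaleDr k s t :
    teqv (TScale k (TAdd s t)) (TAdd (TScale k s) (TScale k t))
| te_scaleDl k l s : teqv (TScale (k + l) s) (TAdd (TScale k s) (TScale l s))
| te_brDl s t u : teqv (TBr (TAdd s t) u) (TAdd (TBr s u) (TBr t u))
| te_brDr s t u : teqv (TBr s (TAdd t u)) (TAdd (TBr s t) (TBr s u))
| te_brZl k s t : teqv (TBr (TScale k s) t) (TScale k (TBr s t))
| te_brZr k s t : teqv (TBr s (TScale k t)) (TScale k (TBr s t))
| te_anti a b s t : thomog a s -> thomog b t ->
    teqv (TBr s t) (TOpp (TScale (sgn a b) (TBr t s)))
| te_jacobi a b c s t u : thomog a s -> thomog b t -> thomog c u ->
    teqv (TBr s (TBr t u))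
         (TAdd (TBr (TBr s t) u) (TScale (sgn a b) (TBr t (TBr s u))))
| te_even s : thomog false s -> teqv (TBr s s) TZero
| te_symZl a b k (m : hpart M a) (n : hpart M b) :
    teqv (TScale k (TSym m n)) (TSym (hscale k m) n)
| te_symZr a b k (m : hpart M a) (n : hpart M b) :
    teqv (TScale k (TSym m n)) (TSym m (hscale k n))
| te_symDl a b (m m' : hpart M a) (n : hpart M b) :
    teqv (TSym (hadd m m') n) (TAdd (TSym m n) (TSym m' n))
| te_symDr a b (m : hpart M a) (n n' : hpart M b) :
    teqv (TSym m (hadd n n')) (TAdd (TSym m n) (TSym m n'))
| te_actl a a' b (m : hpart M a) (m' : hpart M a') (n : hpart M b) :
    teqv (TSym (hbr m m') n)
         (TAdd (TSym m (hbr m' n))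
               (TOpp (TScale (sgn a a') (TSym m' (hbr m n)))))
| te_actr a b b' (m : hpart M a) (n : hpart M b) (n' : hpart M b') :
    teqv (TSym m (hbr n n'))
         (TAdd (TScale (sgn b' (a (+) b)) (TSym (hbr n' m) n))
               (TOpp (TScale (sgn a b) (TSym (hbr n m) n'))))
| te_brsym a b a' b' (m : hpart M a) (n : hpart M b)
    (m' : hpart M a') (n' : hpart M b') :
    teqv (TBr (TSym m n) (TSym m' n'))
         (TOpp (TScale (sgn a b) (TSym (hbr n m) (hbr m' n')))).

Definition tensor_pre : preAlg K := @PreAlg K term teqv TZero (@TAdd K M)
  (@TOpp K M) (@TScale K M) (@TBr K M)
  te_refl te_sym te_trans te_add te_opp te_scale te_br te_addA te_addC te_add0
  te_addN te_scaleA te_scale1 te_scaleDr te_scaleDl te_brDl te_brDr te_brZl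
  te_brZr.

Definition tensor : Type := pquot tensor_pre.
HB.instance Definition _ := GRing.Lmodule.on tensor.

Definition tcls (t : term) : tensor := pcls (t : tensor_pre).

Lemma tcls_eq s t : tcls s = tcls t <-> teqv s t.
Proof. exact: (@pcls_eq _ tensor_pre). Qed.
Lemma tclsP (q : tensor) : exists t, q = tcls t.
Proof. exact: (@pclsP _ tensor_pre). Qed.
Lemma tcls0 : tcls TZero = 0. Proof. by []. Qed.
Lemma tclsD s t : tcls (TAdd s t) = tcls s + tcls t.
Proof. exact: (@pclsD _ tensor_pre). Qed.
Lemma tclsN s : tcls (TOpp s) = - tcls s.
Proof. exact: (@pclsN _ tensor_pre). Qed.
Lemma tclsZ k s : tcls (TScale k s) = k *: tcls s.
Proof. exact: (@pclsZ _ tensor_pre). Qed.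

Definition tbr (q r : tensor) : tensor := @qbr K tensor_pre q r.

Lemma tclsB s t : tcls (TBr s t) = tbr (tcls s) (tcls t).
Proof. by rewrite /tbr /tcls qbrE. Qed.

Definition tensor_homog (a : bool) (q : tensor) : Prop :=
  exists2 t, thomog a t & q = tcls t.

(* The relations being homogeneous, this descends to the quotient, which is   *)
(* therefore the direct sum of its two graded parts.                          *)
Fixpoint tcomp (c : bool) (t : term) : tensor :=
  match t with
  | TSym a b m n => if a (+) b == c then tcls (TSym m n) else 0
  | TZero => 0
  | TAdd s t => tcomp c s + tcomp c t
  | TOpp s => - tcomp c s
  | TScale k s => k *: tcomp c s
  | TBr s t => tbr (tcomp false s) (tcomp c t) +
               tbr (tcomp true s) (tcomp (~~ c) t)
  end.

Let tbrDl (q r s : tensor) : tbr (q + r) s = tbr q s + tbr r s.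
Proof. exact: (@qbrDl _ tensor_pre). Qed.
Let tbrDr (q r s : tensor) : tbr q (r + s) = tbr q r + tbr q s.
Proof. exact: (@qbrDr _ tensor_pre). Qed.
Let tbrZl k (q r : tensor) : tbr (k *: q) r = k *: tbr q r.
Proof. exact: (@qbrZl _ tensor_pre). Qed.
Let tbrZr k (q r : tensor) : tbr q (k *: r) = k *: tbr q r.
Proof. exact: (@qbrZr _ tensor_pre). Qed.
Let tbr0l (q : tensor) : tbr 0 q = 0.
Proof. exact: (@qbr0l _ tensor_pre). Qed.
Let tbr0r (q : tensor) : tbr q 0 = 0.
Proof. exact: (@qbr0r _ tensor_pre). Qed.

Lemma tensor_homog0 a : tensor_homog a 0.
Proof. by exists TZero; first exact: thomog_zero. Qed.

Lemma tensor_homogD a q r :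
  tensor_homog a q -> tensor_homog a r -> tensor_homog a (q + r).
Proof.
case=> s hs -> [t ht ->]; exists (TAdd s t); last by rewrite tclsD.
exact: thomog_add.
Qed.

Lemma tensor_homogZ a (k : K) q : tensor_homog a q -> tensor_homog a (k *: q).
Proof.
case=> s hs ->; exists (TScale k s); last by rewrite tclsZ.
exact: thomog_scale.
Qed.

Lemma tensor_homogB a b q r :
  tensor_homog a q -> tensor_homog b r -> tensor_homog (a (+) b) (tbr q r).
Proof.
case=> s hs -> [t ht ->]; exists (TBr s t); last by rewrite tclsB.
exact: thomog_br.
Qed.

Lemma tcomp_homog c t : tensor_homog c (tcomp c t).
Proof.
elim: t c => [a b m n|| s IHs t IHt | s IHs | k s IHs | s IHs t IHt] c /=.
- case: eqP => [<-|_]; last exact: tensor_homog0.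
  by exists (TSym m n); first exact: thomog_sym.
- exact: tensor_homog0.
- exact: tensor_homogD.
- by rewrite -scaleN1r; apply: tensor_homogZ.
- exact: tensor_homogZ.
- apply: tensor_homogD; first by rewrite -[c]addFb; apply: tensor_homogB.
  by rewrite -{1}[c]negbK -addTb; apply: tensor_homogB.
Qed.

Lemma tcomp_sum t : tcls t = tcomp false t + tcomp true t.
Proof.
elim: t => [a b m n|| s IHs t IHt | s IHs | k s IHs | s IHs t IHt] /=.
- by case: (a (+) b) => /=; rewrite ?add0r ?addr0.
- by rewrite addr0.
- by rewrite tclsD IHs IHt addrACA.
- by rewrite tclsN IHs opprD.
- by rewrite tclsZ IHs scalerDr.
- by rewrite tclsB IHs IHt !(tbrDl, tbrDr) [X in _ + X = _]addrC addrACA.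
Qed.

Lemma tcomp_thomog a t c : thomog a t ->
  tcomp c t = if a == c then tcls t else 0.
Proof.
move=> h; elim: h c => {a t}
  [a b m n|a|a s t _ IHs _ IHt|a s _ IHs|a k s _ IHs|a b s t _ IHs _ IHt] c //=.
- by rewrite if_same.
- by rewrite IHs IHt; case: eqP => _; rewrite ?addr0 ?tclsD.
- by rewrite IHs; case: eqP => _; rewrite ?oppr0 ?tclsN.
- by rewrite IHs; case: eqP => _; rewrite ?scaler0 ?tclsZ.
- rewrite !IHs !IHt tclsB.
  by case: a b c {IHs IHt} => [] [] [] /=; rewrite ?tbr0l ?tbr0r ?addr0 ?add0r.
Qed.

Let tbr_anti a b q r : tensor_homog a q -> tensor_homog b r ->
  tbr q r = - (sgn a b *: tbr r q).
Proof.
case=> s hs -> [t ht ->]; rewrite -!tclsB -tclsZ -tclsN.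
by apply/tcls_eq/te_anti.
Qed.

Let tbr_jacobi a b c q r p :
  tensor_homog a q -> tensor_homog b r -> tensor_homog c p ->
  tbr q (tbr r p) = tbr (tbr q r) p + sgn a b *: tbr r (tbr q p).
Proof.
case=> s hs -> [t ht ->] [u hu ->]; rewrite -!tclsB -tclsZ -tclsD.
by apply/tcls_eq/(te_jacobi hs ht hu).
Qed.

Let tbr_even q : tensor_homog false q -> tbr q q = 0.
Proof. by case=> s hs ->; rewrite -tclsB -tcls0; apply/tcls_eq/te_even. Qed.

Lemma tcomp_eqv s t : teqv s t -> forall c, tcomp c s = tcomp c t.
Proof.
elim=> {s t} //=.
- by move=> s t u _ IH1 _ IH2 c; rewrite IH1.
- by move=> s s' t t' _ IH1 _ IH2 c; rewrite IH1 IH2.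
- by move=> s s' _ IH c; rewrite IH.
- by move=> k s s' _ IH c; rewrite IH.
- by move=> s s' t t' _ IH1 _ IH2 c; rewrite !IH1 !IH2.
- by move=> s t u c; rewrite addrA.
- by move=> s t c; rewrite addrC.
- by move=> s c; rewrite add0r.
- by move=> s c; rewrite addNr.
- by move=> k l s c; rewrite scalerA.
- by move=> s c; rewrite scale1r.
- by move=> k s t c; rewrite scalerDr.
- by move=> k l s c; rewrite scalerDl.
- by move=> s t u c; rewrite !tbrDl addrACA.
- by move=> s t u c; rewrite !tbrDr addrACA.
- by move=> k s t c; rewrite !tbrZl scalerDr.
- by move=> k s t c; rewrite !tbrZr scalerDr.
- move=> a b s t hs ht c; have /= := tcomp_thomog c (thomog_br hs ht).
  have /= -> := tcomp_thomog c (thomog_br ht hs) => ->.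
  rewrite addbC; case: eqP => _; last by rewrite scaler0 oppr0.
  by rewrite -tclsZ -tclsN; apply/tcls_eq/te_anti.
- move=> a b d s t u hs ht hu c.
  have /= -> := tcomp_thomog c (thomog_br hs (thomog_br ht hu)).
  have /= -> := tcomp_thomog c (thomog_br (thomog_br hs ht) hu).
  have /= -> := tcomp_thomog c (thomog_br ht (thomog_br hs hu)).
  rewrite addbA addbCA addbA; case: eqP => _; last by rewrite scaler0 addr0.
  by rewrite -tclsZ -tclsD; apply/tcls_eq/(te_jacobi hs ht hu).
- move=> s hs c; have /= -> := tcomp_thomog c (thomog_br hs hs).
  by case: eqP => // _; rewrite -tcls0; apply/tcls_eq/te_even.
- move=> a b k m n c; case: eqP => _; last by rewrite scaler0.
  by rewrite -tclsZ; apply/tcls_eq/te_symZl.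
- move=> a b k m n c; case: eqP => _; last by rewrite scaler0.
  by rewrite -tclsZ; apply/tcls_eq/te_symZr.
- move=> a b m m' n c; case: eqP => _; last by rewrite addr0.
  by rewrite -tclsD; apply/tcls_eq/te_symDl.
- move=> a b m n n' c; case: eqP => _; last by rewrite addr0.
  by rewrite -tclsD; apply/tcls_eq/te_symDr.
- move=> a a' b m m' n c.
  rewrite -!addbA [a' (+) (a (+) b)]addbCA.
  case: eqP => _; last by rewrite scaler0 subr0.
  by rewrite -tclsZ -tclsN -tclsD; apply/tcls_eq/te_actl.
- move=> a b b' m n n' c.
  rewrite (_ : b' (+) a (+) b = a (+) (b (+) b'));
    last by case: a b b' {m n n'} => [] [] [].
  rewrite (_ : b (+) a (+) b' = a (+) (b (+) b'));
    last by case: a b b' {m n n'} => [] [] [].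
  case: eqP => _; last by rewrite !scaler0 subr0.
  by rewrite -!tclsZ -tclsN -tclsD; apply/tcls_eq/te_actr.
- move=> a b a' b' m n m' n' c.
  have /= -> := tcomp_thomog c (thomog_br (thomog_sym m n) (thomog_sym m' n')).
  rewrite (_ : b (+) a (+) (a' (+) b') = a (+) b (+) (a' (+) b'));
    last by rewrite [b (+) a]addbC.
  case: eqP => _; last by rewrite scaler0 oppr0.
  by rewrite -tclsZ -tclsN; apply/tcls_eq/te_brsym.
Qed.

Lemma tensor_homog_sum q : exists q0 q1,
  [/\ tensor_homog false q0, tensor_homog true q1 & q = q0 + q1].
Proof.
have [t ->] := tclsP q; exists (tcomp false t), (tcomp true t).
by split; [exact: tcomp_homog | exact: tcomp_homog | exact: tcomp_sum].
Qed.

Lemma tensor_homog_direct q :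
  tensor_homog false q -> tensor_homog true q -> q = 0.
Proof.
case=> s hs -> [t ht /tcls_eq/tcomp_eqv/(_ false)].
by rewrite (tcomp_thomog _ hs) (tcomp_thomog _ ht).
Qed.

HB.instance Definition _ := Lmodule_isSupermodule.Build K tensor
  tensor_homog0 tensor_homogD tensor_homogZ tensor_homog_sum
  tensor_homog_direct.

HB.instance Definition _ := Supermodule_isLieSuperalgebra.Build K tensor
  tbrDl tbrDr tbrZl tbrZr tensor_homogB tbr_anti tbr_jacobi tbr_even.

Definition tsym a b (m : hpart M a) (n : hpart M b) : tensor :=
  tcls (TSym m n).

Lemma tsym_homog a b (m : hpart M a) (n : hpart M b) :
  homog (a (+) b) (tsym m n).
Proof. by exists (TSym m n); first exact: thomog_sym. Qed.

Lemma tsym_br a b a' b' (m : hpart M a) (n : hpart M b)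
    (m' : hpart M a') (n' : hpart M b') :
  br (tsym m n) (tsym m' n') =
  - (sgn a b *: tsym (hbr n m) (hbr m' n')).
Proof.
by rewrite /tsym -tclsZ -tclsN -[br _ _]tclsB; apply/tcls_eq/te_brsym.
Qed.

Lemma tsymZl a b k (m : hpart M a) (n : hpart M b) :
  tsym (hscale k m) n = k *: tsym m n.
Proof. by rewrite /tsym -tclsZ; apply/tcls_eq/te_sym/te_symZl. Qed.

Lemma tsymDl a b (m m' : hpart M a) (n : hpart M b) :
  tsym (hadd m m') n = tsym m n + tsym m' n.
Proof. by rewrite /tsym -tclsD; apply/tcls_eq/te_symDl. Qed.

Lemma tensor_ind (Q : tensor -> Prop) :
  (forall a b (m : hpart M a) (n : hpart M b), Q (tsym m n)) -> Q 0 ->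
  (forall q r, Q q -> Q r -> Q (q + r)) -> (forall k q, Q q -> Q (k *: q)) ->
  (forall q r, Q q -> Q r -> Q (br q r)) -> forall q, Q q.
Proof.
move=> Qs Q0 QD QZ QB q; have [t {q}->] := tclsP q.
elim: t => [a b m n|| s IHs t IHt | s IHs | k s IHs | s IHs t IHt] //.
- exact: Qs.
- by rewrite tclsD; apply: QD.
- by rewrite tclsN -scaleN1r; apply: QZ.
- by rewrite tclsZ; apply: QZ.
- by rewrite tclsB; apply: QB.
Qed.

End TensorProduct.

Inductive wedge_ker (K : comPzRingType) (M : lieSuperalgType K) :
    tensor M -> Prop :=
| wk_anti a b (m : hpart M a) (m' : hpart M b) :
    wedge_ker (tsym m m' + sgn a b *: tsym m' m)
| wk_even (m : hpart M false) : wedge_ker (tsym m m)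
| wk_zero : wedge_ker 0
| wk_add x y : wedge_ker x -> wedge_ker y -> wedge_ker (x + y)
| wk_scale (k : K) x : wedge_ker x -> wedge_ker (k *: x).

Section ExteriorProduct.
Variables (K : comPzRingType) (M : lieSuperalgType K).
Implicit Types x y z : tensor M.

Lemma hpart_eq a (m n : hpart M a) : hval m = hval n -> m = n.
Proof.
case: m n => m hm [n hn] /= e; case: _ / e in hn *.
by congr HPart; apply: Prop_irrelevance.
Qed.

Lemma tsym_eql a a' b (m : hpart M a) (m' : hpart M a') (n : hpart M b) :
  a = a' -> hval m = hval m' -> tsym m n = tsym m' n.
Proof. by move=> e; case: _ / e in m' * => /hpart_eq ->. Qed.

Lemma sgn_sq a b : sgn a b * sgn a b = 1 :> K.
Proof. by rewrite /sgn -expr2 sqrr_sign. Qed.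

Lemma sgnC a b : sgn a b = sgn b a :> K.
Proof. by rewrite /sgn andbC. Qed.

Lemma wk_anti_br a b (m : hpart M a) (n : hpart M b) x :
  br (tsym m n + sgn a b *: tsym n m) x = 0.
Proof.
have hz : homog (a (+) b) (tsym m n + sgn a b *: tsym n m).
  apply: homogD; first exact: tsym_homog.
  by apply: homogZ; rewrite addbC; apply: tsym_homog.
elim/tensor_ind: x => [a' b' m' n'||q r|k q|q r].
- rewrite brDl brZl !tsym_br scalerN scalerA [sgn b a]sgnC sgn_sq scale1r.
  rewrite (@tsym_eql _ _ _ (hbr m n) (hscale (- sgn a b) (hbr n m))).
  + by rewrite tsymZl scaleNr opprK addNr.
  + by rewrite addbC.
  + by rewrite /= scaleNr; apply: (br_anti (hvalP m) (hvalP n)).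
- exact: br0r.
- by rewrite brDr => -> ->; rewrite addr0.
- by rewrite brZr => ->; rewrite scaler0.
- exact: br_killed hz.
Qed.

Lemma wk_even_br (m : hpart M false) x : br (tsym m m) x = 0.
Proof.
have hz : homog false (tsym m m) := tsym_homog m m.
elim/tensor_ind: x => [a' b' m' n'||q r|k q|q r].
- rewrite tsym_br (@tsym_eql _ _ _ _ (hscale 0 (hbr m m))) //=.
  + by rewrite tsymZl scale0r scaler0 oppr0.
  + by rewrite (br_even (hvalP m)) scaler0.
- exact: br0r.
- by rewrite brDr => -> ->; rewrite addr0.
- by rewrite brZr => ->; rewrite scaler0.
- exact: br_killed hz.
Qed.

Lemma wedge_ker_homog x : wedge_ker x -> exists x0 x1,
  [/\ homog false x0, homog true x1, wedge_ker x0, wedge_ker x1 & x = x0 + x1].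
Proof.
have one c y : homog c y -> wedge_ker y -> exists x0 x1,
  [/\ homog false x0, homog true x1, wedge_ker x0, wedge_ker x1 & y = x0 + x1].
  case: c => hy ky.
    by exists 0, y; rewrite add0r; split=> //; [exact: homog0 | exact: wk_zero].
  by exists y, 0; rewrite addr0; split=> //; [exact: homog0 | exact: wk_zero].
elim=> {x} [a b m n|m||x y _ [x0 [x1 [? ? ? ? ->]]] _ [y0 [y1 [? ? ? ? ->]]]
           |k x _ [x0 [x1 [? ? ? ? ->]]]].
- apply: (one (a (+) b)); last exact: wk_anti.
  apply: homogD; first exact: tsym_homog.
  by apply: homogZ; rewrite addbC; apply: tsym_homog.
- by apply: (one false); [exact: (tsym_homog m m) | exact: wk_even].
- by apply: (one false); [exact: homog0 | exact: wk_zero].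
- exists (x0 + y0), (x1 + y1).
  split; [exact: homogD | exact: homogD | exact: wk_add | exact: wk_add |].
  exact: addrACA.
- exists (k *: x0), (k *: x1).
  split; [exact: homogZ | exact: homogZ | exact: wk_scale | exact: wk_scale |].
  exact: scalerDr.
Qed.

Lemma wedge_ker_brl z : wedge_ker z -> forall x, br z x = 0.
Proof.
elim=> {z} [a b m n x|m x|x|y z _ IHy _ IHz x|k z _ IHz x].
- exact: wk_anti_br.
- exact: wk_even_br.
- exact: br0l.
- by rewrite brDl IHy IHz addr0.
- by rewrite brZl IHz scaler0.
Qed.

Lemma wedge_ker_brr z : wedge_ker z -> forall x, br x z = 0.
Proof.
move=> /wedge_ker_homog[z0 [z1 [h0 h1 k0 k1 ->]]] x.
rewrite brDr (br_killedC h0 (wedge_ker_brl k0)).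
by rewrite (br_killedC h1 (wedge_ker_brl k1)) addr0.
Qed.

Definition weqv x y := wedge_ker (x - y).

Lemma weqv_eq x y : x = y -> weqv x y.
Proof. by move=> ->; rewrite /weqv subrr; apply: wk_zero. Qed.

Lemma wk_opp x : wedge_ker x -> wedge_ker (- x).
Proof. by rewrite -scaleN1r; apply: wk_scale. Qed.

Lemma weqv_sym x y : weqv x y -> weqv y x.
Proof. by move=> /wk_opp; rewrite opprB. Qed.

Lemma weqv_trans x y z : weqv x y -> weqv y z -> weqv x z.
Proof. by move=> h1 h2; have := wk_add h1 h2; rewrite addrA subrK. Qed.

Lemma weqv_add x x' y y' : weqv x x' -> weqv y y' -> weqv (x + y) (x' + y').
Proof. by move=> h1 h2; have := wk_add h1 h2; rewrite addrACA -opprD. Qed.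

Lemma weqv_opp x x' : weqv x x' -> weqv (- x) (- x').
Proof. by move=> /wk_opp; rewrite opprD. Qed.

Lemma weqv_scale (k : K) x x' : weqv x x' -> weqv (k *: x) (k *: x').
Proof. by move=> /(wk_scale k); rewrite scalerBr. Qed.

Lemma weqv_br x x' y y' : weqv x x' -> weqv y y' -> weqv (br x y) (br x' y').
Proof.
move=> /wedge_ker_brl hx /wedge_ker_brr hy; apply: weqv_eq.
have := hx y; rewrite brDl brNl => /subr0_eq ->.
by have := hy x'; rewrite brDr brNr => /subr0_eq ->.
Qed.

Definition exterior_pre : preAlg K.
Proof.
apply: (@PreAlg K (tensor M) weqv 0 +%R -%R *:%R br);
  [by move=> x; apply: weqv_eq|exact: weqv_sym|exact: weqv_trans|exact: weqv_add
  |exact: weqv_opp|exact: weqv_scale|exact: weqv_br|..] => *; apply: weqv_eq.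
- exact: addrA.
- exact: addrC.
- exact: add0r.
- exact: addNr.
- exact: scalerA.
- exact: scale1r.
- exact: scalerDr.
- exact: scalerDl.
- exact: brDl.
- exact: brDr.
- exact: brZl.
- exact: brZr.
Defined.

Definition exterior : Type := pquot exterior_pre.
HB.instance Definition _ := GRing.Lmodule.on exterior.

Definition wcls (x : tensor M) : exterior := pcls (x : exterior_pre).

Lemma wcls_eq x y : wcls x = wcls y <-> wedge_ker (x - y).
Proof. exact: (@pcls_eq _ exterior_pre). Qed.
Lemma wclsP (q : exterior) : exists x, q = wcls x.
Proof. exact: (@pclsP _ exterior_pre). Qed.
Lemma wcls0 : wcls 0 = 0. Proof. by []. Qed.
Lemma wclsD x y : wcls (x + y) = wcls x + wcls y.
Proof. exact: (@pclsD _ exterior_pre). Qed.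
Lemma wclsN x : wcls (- x) = - wcls x.
Proof. exact: (@pclsN _ exterior_pre). Qed.
Lemma wclsZ k x : wcls (k *: x) = k *: wcls x.
Proof. exact: (@pclsZ _ exterior_pre). Qed.

Definition wbr (q r : exterior) : exterior := @qbr K exterior_pre q r.

Lemma wclsB x y : wcls (br x y) = wbr (wcls x) (wcls y).
Proof. by rewrite /wbr /wcls qbrE. Qed.

Definition exterior_homog (a : bool) (q : exterior) : Prop :=
  exists2 x, homog a x & q = wcls x.

Let wbrDl (q r s : exterior) : wbr (q + r) s = wbr q s + wbr r s.
Proof. exact: (@qbrDl _ exterior_pre). Qed.
Let wbrDr (q r s : exterior) : wbr q (r + s) = wbr q r + wbr q s.
Proof. exact: (@qbrDr _ exterior_pre). Qed.
Let wbrZl k (q r : exterior) : wbr (k *: q) r = k *: wbr q r.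
Proof. exact: (@qbrZl _ exterior_pre). Qed.
Let wbrZr k (q r : exterior) : wbr q (k *: r) = k *: wbr q r.
Proof. exact: (@qbrZr _ exterior_pre). Qed.

Let exterior_homog0 a : exterior_homog a 0.
Proof. by exists 0; first exact: homog0. Qed.

Let exterior_homogD a q r :
  exterior_homog a q -> exterior_homog a r -> exterior_homog a (q + r).
Proof.
by case=> s hs -> [t ht ->]; exists (s + t); [exact: homogD | rewrite wclsD].
Qed.

Let exterior_homogZ a (k : K) q :
  exterior_homog a q -> exterior_homog a (k *: q).
Proof.
by case=> s hs ->; exists (k *: s); [exact: homogZ | rewrite wclsZ].
Qed.

Let exterior_homogB a b q r : exterior_homog a q -> exterior_homog b r ->
  exterior_homog (a (+) b) (wbr q r).
Proof.
by case=> s hs -> [t ht ->]; exists (br s t); [exact: homog_br | rewrite wclsB].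
Qed.

Let exterior_homog_sum q : exists q0 q1,
  [/\ exterior_homog false q0, exterior_homog true q1 & q = q0 + q1].
Proof.
have [x ->] := wclsP q; have [x0 [x1 [h0 h1 ->]]] := homog_sum x.
by exists (wcls x0), (wcls x1); split; [exists x0 | exists x1 | rewrite wclsD].
Qed.

Let exterior_homog_direct q :
  exterior_homog false q -> exterior_homog true q -> q = 0.
Proof.
case=> x hx -> [y hy /wcls_eq/wedge_ker_homog[z0 [z1 [h0 h1 k0 _ e]]]].
suff xz : x - z0 = 0.
  by rewrite -wcls0; apply/wcls_eq; rewrite subr0 (subr0_eq xz).
have hx0 : homog false (x - z0) by apply: homogD => //; apply: homogN.
have hy1 : homog true (- (y + z1)) by apply/homogN/homogD.
apply: (proj1 (homog_split hx0 hy1 _)); rewrite opprD addrACA.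
by rewrite e -opprD subrr.
Qed.

HB.instance Definition _ := Lmodule_isSupermodule.Build K exterior
  exterior_homog0 exterior_homogD exterior_homogZ exterior_homog_sum
  exterior_homog_direct.

Let wbr_anti a b (q r : exterior) : homog a q -> homog b r ->
  wbr q r = - (sgn a b *: wbr r q).
Proof.
by case=> s hs -> [t ht ->]; rewrite -!wclsB (br_anti hs ht) wclsN wclsZ.
Qed.

Let wbr_jacobi a b c (q r p : exterior) : homog a q -> homog b r ->
  homog c p -> wbr q (wbr r p) = wbr (wbr q r) p + sgn a b *: wbr r (wbr q p).
Proof.
case=> s hs -> [t ht ->] [u hu ->].
by rewrite -!wclsB (br_jacobi hs ht hu) wclsD wclsZ.
Qed.

Let wbr_even (q : exterior) : homog false q -> wbr q q = 0.
Proof. by case=> s hs ->; rewrite -wclsB (br_even hs). Qed.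

HB.instance Definition _ := Supermodule_isLieSuperalgebra.Build K exterior
  wbrDl wbrDr wbrZl wbrZr exterior_homogB wbr_anti wbr_jacobi wbr_even.

Definition wedge a b (m : hpart M a) (n : hpart M b) : exterior :=
  wcls (tsym m n).

End ExteriorProduct.

(* The homomorphism m /\ n |-> [m, n], obtained by evaluating expressions.    *)
Section BracketMap.
Variables (K : comPzRingType) (M : lieSuperalgType K).

Fixpoint teval (t : tterm M) : M :=
  match t with
  | TSym _ _ m n => br (hval m) (hval n)
  | TZero => 0
  | TAdd s t => teval s + teval t
  | TOpp s => - teval s
  | TScale k s => k *: teval s
  | TBr s t => br (teval s) (teval t)
  end.

Lemma teval_homog a t : thomog a t -> homog a (teval t).
Proof.
elim=> {a t} /=.
- by move=> a b m n; apply: homog_br; apply: hvalP.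
- by move=> a; apply: homog0.
- by move=> a s t _ hs _ ht; apply: homogD.
- by move=> a s _ hs; apply: homogN.
- by move=> a k s _ hs; apply: homogZ.
- by move=> a b s t _ hs _ ht; apply: homog_br.
Qed.

Lemma teval_eqv s t : teqv s t -> teval s = teval t.
Proof.
elim=> {s t} //=.
- by move=> s t u _ -> _ ->.
- by move=> s s' t t' _ -> _ ->.
- by move=> s s' _ ->.
- by move=> k s s' _ ->.
- by move=> s s' t t' _ -> _ ->.
- by move=> *; rewrite addrA.
- by move=> *; rewrite addrC.
- by move=> *; rewrite add0r.
- by move=> *; rewrite addNr.
- by move=> *; rewrite scalerA.
- by move=> *; rewrite scale1r.
- by move=> *; rewrite scalerDr.
- by move=> *; rewrite scalerDl.
- by move=> *; rewrite brDl.
- by move=> *; rewrite brDr.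
- by move=> *; rewrite brZl.
- by move=> *; rewrite brZr.
- by move=> a b s t /teval_homog hs /teval_homog ht; rewrite (br_anti hs ht).
- move=> a b c s t u /teval_homog hs /teval_homog ht /teval_homog hu.
  exact: br_jacobi hs ht hu.
- by move=> s /teval_homog /br_even.
- by move=> *; rewrite brZl.
- by move=> *; rewrite brZr.
- by move=> *; rewrite brDl.
- by move=> *; rewrite brDr.
- move=> a a' b m m' n.
  by rewrite (br_jacobi (hvalP m) (hvalP m') (hvalP n)) addrK.
- move=> a b b' m n n'.
  rewrite (br_jacobi (hvalP m) (hvalP n) (hvalP n')) addrC; congr (_ + _).
    rewrite (br_anti (hvalP n) (homog_br (hvalP m) (hvalP n'))).
    rewrite (br_anti (hvalP m) (hvalP n')) brNl brZl !scalerN opprK !scalerA.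
    congr (_ *: _).
    case: a b b' {m n n'} => [] [] [];
      by rewrite /sgn /= ?expr0 ?expr1 !(mulrNN, mul1r, mulr1).
  by rewrite (br_anti (hvalP m) (hvalP n)) brNl brZl.
- move=> a b a' b' m n m' n'.
  by rewrite (br_anti (hvalP m) (hvalP n)) brNl brZl.
Qed.

Definition tensor_br (q : tensor M) : M :=
  teval (prep (q : pquot (tensor_pre M))).

Lemma tensor_brE t : tensor_br (tcls t) = teval t.
Proof. exact/teval_eqv/(prep_cls (P := tensor_pre M)). Qed.

Lemma tensor_brD q r : tensor_br (q + r) = tensor_br q + tensor_br r.
Proof.
have [s ->] := tclsP q; have [t ->] := tclsP r.
by rewrite -tclsD !tensor_brE.
Qed.

Lemma tensor_brZ k q : tensor_br (k *: q) = k *: tensor_br q.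
Proof. by have [s ->] := tclsP q; rewrite -tclsZ !tensor_brE. Qed.

Lemma tensor_brB q r : tensor_br (br q r) = br (tensor_br q) (tensor_br r).
Proof.
have [s ->] := tclsP q; have [t ->] := tclsP r.
by rewrite -[br (tcls s) _]tclsB !tensor_brE.
Qed.

Lemma tensor_br_ker q : wedge_ker q -> tensor_br q = 0.
Proof.
elim=> {q} [a b m n|m||x y _ IHx _ IHy|k x _ IHx].
- rewrite tensor_brD tensor_brZ !tensor_brE /=.
  by rewrite (br_anti (hvalP m) (hvalP n)) addNr.
- by rewrite tensor_brE /= (br_even (hvalP m)).
- by rewrite -tcls0 tensor_brE.
- by rewrite tensor_brD IHx IHy addr0.
- by rewrite tensor_brZ IHx scaler0.
Qed.

Definition wedge_br (q : exterior M) : M :=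
  tensor_br (prep (q : pquot (exterior_pre M))).

Lemma wedge_br_cls x : wedge_br (wcls x) = tensor_br x.
Proof.
have /tensor_br_ker := prep_cls (P := exterior_pre M) x.
by rewrite tensor_brD -scaleN1r tensor_brZ scaleN1r => /subr0_eq.
Qed.

Lemma wedge_br_linear : linear wedge_br.
Proof.
move=> k q r; have [x ->] := wclsP q; have [y ->] := wclsP r.
by rewrite -wclsZ -wclsD !wedge_br_cls tensor_brD tensor_brZ.
Qed.

HB.instance Definition _ :=
  GRing.isLinear.Build K (exterior M) M *:%R wedge_br wedge_br_linear.

Lemma wedge_br_homog a q : homog a q -> homog a (wedge_br q).
Proof.
case=> _ [t ht ->] ->; rewrite wedge_br_cls tensor_brE.
exact: teval_homog.
Qed.

Lemma wedge_br_br q r : wedge_br (br q r) = br (wedge_br q) (wedge_br r).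
Proof.
have [x ->] := wclsP q; have [y ->] := wclsP r.
by rewrite -[br (wcls x) _]wclsB !wedge_br_cls tensor_brB.
Qed.

HB.instance Definition _ :=
  isLieSuperHom.Build K (exterior M) M wedge_br wedge_br_homog wedge_br_br.

Lemma wedge_brE a b (m : hpart M a) (n : hpart M b) :
  wedge_br (wedge m n) = br (hval m) (hval n).
Proof. by rewrite wedge_br_cls tensor_brE. Qed.

End BracketMap.

Arguments wedge_br {K} M q.

(* Main.v *)
(** For any Lie superalgebra M, the supermodule E = M (+) (M /\ M) is a Lie
    superalgebra under [e, e'] = (0, p e /\ p e'), where p (x, g) = x + d g
    and d : M /\ M -> M is the bracket map; p is then a homomorphism onto M.
    When M = F is free, sending each generator x to (x, 0) defines a section
    h of p, so that h [x, y] = (0, p (h x) /\ p (h y)) = (0, x /\ y).  Hence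
    h (d g) = (0, g) for every g, and d is injective. *)

Require Import Defs.
From mathcomp Require Import all_boot ssralg.
From HB Require Import structures.
From mathcomp Require Import boolp.

Set Implicit Arguments.
Unset Strict Implicit.
Unset Printing Implicit Defensive.

Import GRing.Theory.
Local Open Scope ring_scope.

(** * Homogeneous components in a supermodule *)

Section Components.
Variables (K : comPzRingType) (M : supermodType K).
Implicit Types x y : M.

(** The differences [x - x'] and [y - y'] have opposite degrees and sum to 0, so directness kills
    both. *)
Lemma homog_eq a x x' y y' : homog a x -> homog a x' ->
  homog (~~ a) y -> homog (~~ a) y' -> x + y = x' + y' -> x = x'.
Proof.
move=> hx hx' hy hy' e; apply: subr0_eq.
apply: (proj1 (@homog_split _ _ a _ (y - y') _ _ _)).
- by apply: homogD => //; apply: homogN.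
- by apply: homogD => //; apply: homogN.
- by rewrite addrACA -opprD e subrr.
Qed.

Lemma homog_comp_exists x : exists c : bool -> M,
  (forall a, homog a (c a)) /\ x = c false + c true.
Proof.
have [x0 [x1 [h0 h1 ->]]] := homog_sum x.
by exists (fun a => if a then x1 else x0); split=> // -[].
Qed.

(** The grading only asserts that a decomposition exists, so the components are obtained by choice;
    [hcomp_uniq] shows that they do not depend on it. *)
Definition hcomp a x : hpart M a :=
  HPart ((svalP (cid (homog_comp_exists x))).1 a).

Lemma hcomp_sum x : x = hval (hcomp false x) + hval (hcomp true x).
Proof. exact: (svalP (cid (homog_comp_exists x))).2. Qed.

Lemma hcomp_uniq a x y z : homog a y -> homog (~~ a) z -> x = y + z ->
  hval (hcomp a x) = y.
Proof.
move=> hy hz e; apply: (homog_eq (hvalP _) hy (hvalP (hcomp (~~ a) x)) hz).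
(* For [a = true] the two components come in the reverse order. *)
by rewrite -e [RHS]hcomp_sum; case: a {hy hz} => //=; rewrite addrC.
Qed.

Lemma hcomp_homog a x : homog a x -> hval (hcomp a x) = x.
Proof. by move=> hx; apply: (hcomp_uniq hx (homog0 _)); rewrite addr0. Qed.

Lemma hcomp_homogN a x : homog a x -> hval (hcomp (~~ a) x) = 0.
Proof.
move=> hx; apply: (@hcomp_uniq _ _ _ x (homog0 _)); rewrite ?negbK //.
by rewrite add0r.
Qed.

Lemma hval_hcomp_linear a k x y :
  hval (hcomp a (k *: x + y)) = k *: hval (hcomp a x) + hval (hcomp a y).
Proof.
(* By uniqueness it suffices to exhibit the part of the other degree: the same combination of the
   other components. *)
apply: (@hcomp_uniq _ _ _ (k *: hval (hcomp (~~ a) x) + hval (hcomp (~~ a) y))).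
- by apply: homogD; [apply: homogZ|]; apply: hvalP.
- by apply: homogD; [apply: homogZ|]; apply: hvalP.
- rewrite addrACA -scalerDr {1}[x]hcomp_sum {1}[y]hcomp_sum.
  by case: a => //=; congr (_ *: _ + _); rewrite addrC.
Qed.

End Components.

(** * The exterior product as a bilinear operation on all elements *)

Section Wedge.
Variables (K : comPzRingType) (M : lieSuperalgType K).
Implicit Types x y z : M.

Lemma wedge_linearl a b k (m m' : hpart M a) (n : hpart M b) :
  wedge (hadd (hscale k m) m') n = k *: wedge m n + wedge m' n.
Proof. by rewrite /wedge tsymDl tsymZl wclsD wclsZ. Qed.

Lemma wedge_linearr a b k (m : hpart M a) (n n' : hpart M b) :
  wedge m (hadd (hscale k n) n') = k *: wedge m n + wedge m n'.
Proof.
rewrite /wedge -wclsZ -wclsD; congr wcls.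
rewrite /tsym -tclsZ -tclsD; apply/tcls_eq.
by apply: (te_trans (te_symDr _ _ _)); apply: te_add;
  [exact/te_sym/te_symZr | exact: te_refl].
Qed.

Lemma wedge0l a b (m : hpart M a) (n : hpart M b) : hval m = 0 -> wedge m n = 0.
Proof.
(* As [m] represents 0, it equals -m + m, and linearity makes the two contributions cancel. *)
move=> m0; rewrite (_ : m = hadd (hscale (-1) m) m) ?wedge_linearl.
  by rewrite scaleN1r addNr.
by apply: hpart_eq; rewrite /= m0 scaler0 addr0.
Qed.

Lemma wedge0r a b (m : hpart M a) (n : hpart M b) : hval n = 0 -> wedge m n = 0.
Proof.
move=> n0; rewrite (_ : n = hadd (hscale (-1) n) n) ?wedge_linearr.
  by rewrite scaleN1r addNr.
by apply: hpart_eq; rewrite /= n0 scaler0 addr0.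
Qed.

(** Symbols exist only for homogeneous elements with a given degree. This is their biadditive
    extension, needed because the bracket on [wext] takes arbitrary arguments. *)
Definition wed x y : exterior M :=
  wedge (hcomp false x) (hcomp false y) + wedge (hcomp false x) (hcomp true y) +
  (wedge (hcomp true x) (hcomp false y) + wedge (hcomp true x) (hcomp true y)).

Lemma hcomp_hval a (m : hpart M a) : hcomp a (hval m) = m.
Proof. by apply: hpart_eq; apply: hcomp_homog; apply: hvalP. Qed.

(** Three of the four summands contain a component of the wrong degree, which is 0. *)
Lemma wed_hval a b (m : hpart M a) (n : hpart M b) :
  wed (hval m) (hval n) = wedge m n.
Proof.
have m0 := hcomp_homogN (hvalP m); have n0 := hcomp_homogN (hvalP n).
rewrite -[in RHS](hcomp_hval m) -[in RHS](hcomp_hval n) /wed.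
by case: a m m0 => m m0; case: b n n0 => n n0;
  rewrite ?(wedge0l _ m0) ?(wedge0r _ n0) ?add0r ?addr0.
Qed.

Lemma wed_homogE a b x y (hx : homog a x) (hy : homog b y) :
  wed x y = wedge (HPart hx) (HPart hy).
Proof. exact: (wed_hval (HPart hx) (HPart hy)). Qed.

Lemma hcomp_linear a k x y :
  hcomp a (k *: x + y) = hadd (hscale k (hcomp a x)) (hcomp a y).
Proof. by apply: hpart_eq; rewrite hval_hcomp_linear. Qed.

Lemma wed_linearl k x y z : wed (k *: x + y) z = k *: wed x z + wed y z.
Proof.
rewrite /wed !hcomp_linear !wedge_linearl !scalerDr.
(* The summands in odd position are those that carry the factor [k]. *)
by rewrite [LHS](AC ((2*2)*(2*2)) (((1*3)*(5*7))*((2*4)*(6*8)))).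
Qed.

Lemma wed_linearr k x y z : wed x (k *: y + z) = k *: wed x y + wed x z.
Proof.
rewrite /wed !hcomp_linear !wedge_linearr !scalerDr.
by rewrite [LHS](AC ((2*2)*(2*2)) (((1*3)*(5*7))*((2*4)*(6*8)))).
Qed.

Lemma wedDl x y z : wed (x + y) z = wed x z + wed y z.
Proof. by have := wed_linearl 1 x y z; rewrite !scale1r. Qed.

Lemma wedDr x y z : wed x (y + z) = wed x y + wed x z.
Proof. by have := wed_linearr 1 x y z; rewrite !scale1r. Qed.

Lemma wed0l y : wed 0 y = 0.
Proof. by apply: (addrI (wed 0 y)); rewrite -wedDl !addr0. Qed.

Lemma wed0r x : wed x 0 = 0.
Proof. by apply: (addrI (wed x 0)); rewrite -wedDr !addr0. Qed.

Lemma wedZl k x y : wed (k *: x) y = k *: wed x y.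
Proof. by have := wed_linearl k x 0 y; rewrite wed0l !addr0. Qed.

Lemma wedZr k x y : wed x (k *: y) = k *: wed x y.
Proof. by have := wed_linearr k x y 0; rewrite wed0r !addr0. Qed.

Lemma wed_homog a b x y :
  homog a x -> homog b y -> homog (a (+) b) (wed x y).
Proof.
move=> hx hy; rewrite (wed_homogE hx hy).
by exists (tsym (HPart hx) (HPart hy)); first exact: tsym_homog.
Qed.

Lemma wed_anti a b x y : homog a x -> homog b y ->
  wed x y = - (sgn a b *: wed y x).
Proof.
move=> hx hy; rewrite (wed_homogE hx hy) (wed_homogE hy hx) /wedge.
rewrite -wclsZ -wclsN; apply/wcls_eq.
by rewrite opprK; apply: (wk_anti (HPart hx) (HPart hy)).
Qed.

Lemma wed_even x : homog false x -> wed x x = 0.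
Proof.
move=> hx; rewrite (wed_homogE hx hx) -wcls0; apply/wcls_eq.
by rewrite subr0; apply: wk_even.
Qed.

(** This is the defining relation for [x, y] (x) z, rearranged; the Jacobi identity of [wext]
    reduces to it. *)
Lemma wed_jacobi a b c x y z : homog a x -> homog b y -> homog c z ->
  wed x (br y z) = wed (br x y) z + sgn a b *: wed y (br x z).
Proof.
move=> hx hy hz.
have := @wed_hval _ _ (hbr (HPart hx) (HPart hy)) (HPart hz).
have := @wed_hval _ _ (HPart hx) (hbr (HPart hy) (HPart hz)).
have := @wed_hval _ _ (HPart hy) (hbr (HPart hx) (HPart hz)).
move=> /= -> -> ->; rewrite /wedge -wclsZ -wclsD; congr wcls.
have := te_actl (HPart hx) (HPart hy) (HPart hz) => /tcls_eq.
by rewrite tclsD tclsN tclsZ -/(tsym _ _) => ->; rewrite subrK.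
Qed.

Lemma wedge_br_wed x y : wedge_br M (wed x y) = br x y.
Proof.
rewrite [in RHS](hcomp_sum x) [in RHS](hcomp_sum y) !(brDl, brDr).
by rewrite /wed !raddfD /= !wedge_brE addrACA.
Qed.

End Wedge.

(** * The Lie superalgebra E and its projection p onto M *)

Section Extension.
Variables (K : comPzRingType) (M : lieSuperalgType K).

Definition wext : Type := (M * exterior M)%type.
HB.instance Definition _ := GRing.Lmodule.on wext.
Implicit Types e : wext.

Definition wproj e : M := e.1 + wedge_br M e.2.

Lemma wproj_linear : linear wproj.
Proof.
by move=> k e e'; rewrite /wproj wedge_br_linear scalerDr addrACA.
Qed.

HB.instance Definition _ :=
  GRing.isLinear.Build K wext M *:%R wproj wproj_linear.

Definition wext_homog a e : Prop := homog a e.1 /\ homog a e.2.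

Definition wext_br e e' : wext := (0, wed (wproj e) (wproj e')).

Let wext_homog0 a : wext_homog a 0.
Proof. by split; apply: homog0. Qed.

Let wext_homogD a e e' :
  wext_homog a e -> wext_homog a e' -> wext_homog a (e + e').
Proof. by case=> ? ? [? ?]; split; apply: homogD. Qed.

Let wext_homogZ a (k : K) e : wext_homog a e -> wext_homog a (k *: e).
Proof. by case=> ? ?; split; apply: homogZ. Qed.

Let wext_homog_sum e : exists e0 e1,
  [/\ wext_homog false e0, wext_homog true e1 & e = e0 + e1].
Proof.
case: e => x g; have [x0 [x1 [hx0 hx1 ->]]] := homog_sum x.
have [g0 [g1 [hg0 hg1 ->]]] := homog_sum g.
by exists (x0, g0), (x1, g1).
Qed.

Let wext_homog_direct e : wext_homog false e -> wext_homog true e -> e = 0.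
Proof.
case: e => x g [/= hx hg] [/= hx' hg'].
by rewrite (homog_direct hx hx') (homog_direct hg hg').
Qed.

HB.instance Definition _ := Lmodule_isSupermodule.Build K wext
  wext_homog0 wext_homogD wext_homogZ wext_homog_sum wext_homog_direct.

Lemma wproj_homog a e : homog a e -> homog a (wproj e).
Proof. by case=> hx hg; apply: homogD => //; apply: lie_homog. Qed.

(** Proved before the Lie axioms on [wext], since it rewrites the nested brackets in the Jacobi
    identity as brackets in [M]. *)
Lemma wproj_br e e' : wproj (wext_br e e') = br (wproj e) (wproj e').
Proof. by rewrite /wproj /= add0r wedge_br_wed. Qed.

(** Brackets have first coordinate 0, so this axiom and the following ones reduce to properties of
    [wed] at images under [wproj]. *)
Let wext_brDl e e' e'' : wext_br (e + e') e'' = wext_br e e'' + wext_br e' e''.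
Proof. by rewrite /wext_br raddfD wedDl [RHS]surjective_pairing /= addr0. Qed.

Let wext_brDr e e' e'' : wext_br e (e' + e'') = wext_br e e' + wext_br e e''.
Proof. by rewrite /wext_br raddfD wedDr [RHS]surjective_pairing /= addr0. Qed.

Let wext_brZl k e e' : wext_br (k *: e) e' = k *: wext_br e e'.
Proof. by rewrite /wext_br linearZ wedZl [RHS]surjective_pairing /= scaler0. Qed.

Let wext_brZr k e e' : wext_br e (k *: e') = k *: wext_br e e'.
Proof. by rewrite /wext_br linearZ wedZr [RHS]surjective_pairing /= scaler0. Qed.

Let wext_homog_br a b e e' : homog a e -> homog b e' ->
  homog (a (+) b) (wext_br e e').
Proof.
move=> /wproj_homog he /wproj_homog he'.
by split; [exact: homog0 | exact: wed_homog].
Qed.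

Let wext_br_anti a b e e' : homog a e -> homog b e' ->
  wext_br e e' = - (sgn a b *: wext_br e' e).
Proof.
move=> /wproj_homog he /wproj_homog he'.
by rewrite /wext_br (wed_anti he he') [RHS]surjective_pairing /= scaler0 oppr0.
Qed.

Let wext_br_jacobi a b c e e' e'' : homog a e -> homog b e' -> homog c e'' ->
  wext_br e (wext_br e' e'') =
  wext_br (wext_br e e') e'' + sgn a b *: wext_br e' (wext_br e e'').
Proof.
move=> /wproj_homog he /wproj_homog he' /wproj_homog he''.
apply: injective_projections => /=; first by rewrite scaler0 addr0.
by rewrite !wproj_br; apply: wed_jacobi he he' he''.
Qed.

Let wext_br_even e : homog false e -> wext_br e e = 0.
Proof. by move=> /wproj_homog he; rewrite /wext_br wed_even. Qed.

HB.instance Definition _ := Supermodule_isLieSuperalgebra.Build K wext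
  wext_brDl wext_brDr wext_brZl wext_brZr wext_homog_br wext_br_anti
  wext_br_jacobi wext_br_even.

HB.instance Definition _ :=
  isLieSuperHom.Build K wext M wproj wproj_homog wproj_br.

End Extension.

(** * Composite and identity homomorphisms, to which uniqueness in freeness is applied *)

Section LieHomComposition.
Variables (K : comPzRingType) (L M N : lieSuperalgType K).
Variables (f : lieSuperHom M N) (g : lieSuperHom L M).

Let comp_homog a x : homog a x -> homog a ((f \o g) x).
Proof. by move=> hx; do 2!apply: lie_homog. Qed.

Let comp_br x y : (f \o g) (br x y) = br ((f \o g) x) ((f \o g) y).
Proof. by rewrite /= !lie_br. Qed.

HB.instance Definition _ :=
  isLieSuperHom.Build K L N (f \o g) comp_homog comp_br.

End LieHomComposition.

HB.instance Definition _ (K : comPzRingType) (M : lieSuperalgType K) :=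
  isLieSuperHom.Build K M M idfun (fun _ _ hx => hx) (fun _ _ => erefl).

(** * Linear generation by symbols, and sections of p *)

Section Span.
Variables (K : comPzRingType) (M : lieSuperalgType K).

Inductive tsym_span : tensor M -> Prop :=
| tspan_sym a b (m : hpart M a) (n : hpart M b) : tsym_span (tsym m n)
| tspan0 : tsym_span 0
| tspanD q r : tsym_span q -> tsym_span r -> tsym_span (q + r)
| tspanZ (k : K) q : tsym_span q -> tsym_span (k *: q).

(** The symbols generate the tensor product under brackets; since the bracket of two symbols is a
    multiple of a symbol, their linear span is already closed under brackets. *)
Lemma tsym_spanP q : tsym_span q.
Proof.
elim/tensor_ind: q => [a b m n||q r|k q|q r hq hr]; [exact: tspan_sym|
  exact: tspan0|exact: tspanD|exact: tspanZ|].
elim: hq => {q} [a b m n||q q' _ IH _ IH'|k q _ IH].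
- elim: hr => {r} [a' b' m' n'||r r' _ IH _ IH'|k r _ IH].
  + by rewrite tsym_br -scaleN1r; do 2!apply: tspanZ; apply: tspan_sym.
  + by rewrite br0r; apply: tspan0.
  + by rewrite brDr; apply: tspanD.
  + by rewrite brZr; apply: tspanZ.
- by rewrite br0l; apply: tspan0.
- by rewrite brDl; apply: tspanD.
- by rewrite brZl; apply: tspanZ.
Qed.

(** Both sides are linear in [q], so symbols suffice. There [h] turns the bracket of [m] and [n]
    into a bracket in [wext], which depends only on the images under [wproj], namely [m] and [n]
    again. *)
Lemma wedge_br_section (h : lieSuperHom M (wext M)) :
  @wproj K M \o h =1 id -> forall q, h (wedge_br M q) = (0, q).
Proof.
move=> hK q; have [x ->] := wclsP q; rewrite wedge_br_cls.
elim: (tsym_spanP x) => {q x} [a b m n||x y _ IHx _ IHy|k x _ IHx].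
- rewrite tensor_brE lie_br -/(wedge m n) -wed_hval.
  by congr (_, wed _ _); exact: hK.
- by rewrite -tcls0 tensor_brE raddf0 wcls0.
- by rewrite tensor_brD raddfD /= IHx IHy wclsD [LHS]surjective_pairing /= addr0.
- by rewrite tensor_brZ linearZ /= IHx wclsZ [LHS]surjective_pairing /= scaler0.
Qed.

End Span.

Theorem proposition6p3 (K : comPzRingType) (X : Type) (deg : X -> bool)
    (F : lieSuperalgType K) (i : X -> F)
    (hF : is_free_lie_superalgebra deg i) :
  injective (wedge_br F : lieSuperHom (exterior F) F).
Proof.
have [hi univ] := hF.
have [|h [hE _]] := univ (wext F) (fun x => (i x, 0)).
  by move=> x; split; [exact: hi | exact: homog0].
have [u [_ uniq]] := univ F i hi.
(* Both [wproj \o h] and the identity extend [i], so both equal the unique extension [u]. *)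
have hK : @wproj K F \o h =1 id.
  move=> x; rewrite [LHS](uniq (@wproj K F \o h : lieSuperHom F F)).
    by rewrite -(uniq (idfun : lieSuperHom F F)).
  by move=> y /=; rewrite hE /wproj /= raddf0 addr0.
(* Applying [h] to the common image yields (0, q) = (0, r). *)
move=> q r /= e; have := wedge_br_section hK q.
by rewrite e wedge_br_section // => -[].
Qed.
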